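(* Let $T>0$ and suppose that $f\in\mathcal{A}_{T,\beta}$ for some $\beta>0$. Let $f$ be approximated, for positive even integers $N$, by the $N/2$-degree, $T$-periodic truncated Fourier series $$\Pi_N f(x)=\sum_{|k|\le N/2}\hat f_k\,e^{i\omega_k x},$$ where $\hat f_k=\frac1T\int_0^T f(x)e^{-i\omega_k x}\,dx$ ($k\in\mathbb{Z}$) are the Fourier series coefficients of $f$. Then $$|\hat f_k| = O\left(e^{-\omega_{|k|\beta}}\right)\quad\text{as } |k|\to\infty .$$
   Context: Notation: $\omega_\alpha=\frac{2\pi\alpha}{T}$ for every real $\alpha$; thus $\omega_k=2\pi k/T$ and $\omega_{|k|\beta}=2\pi|k|\beta/T$. For $\beta>0$, $\mathbf{C}_{T,\beta}=\{x+iy: x\in[0,T],\ y\in[-\beta,\beta]\}\subset\mathbb{C}$. For $s\in\mathbb{Z}_{\ge 0}$, $\mathcal{H}_T^s$ is the set of $u$ in the Sobolev space $H^s([0,T])$ (derivatives up to order $s$ in $L^2$) such that $u^{(s)}$ is of bounded variation on $[0,T]$ and $u^{(j)}(0)=u^{(j)}(T)$ for $j=0,\dots,s-1$; $\mathcal{H}_T^\infty$ is the set of functions belonging to $\mathcal{H}_T^s$ for all $s$ (in particular $u^{(j)}(0)=u^{(j)}(T)$ for all $j\ge0$). Functions are allowed to be complex-valued. $\mathcal{A}_{T,\beta}=\{u\in\mathcal{H}_T^\infty: u \text{ is analytic in some open set containing } \mathbf{C}_{T,\beta}\}$. *)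

(* Defs.v *)
From HB Require Import structures.
From mathcomp Require Import all_boot all_order all_algebra.
From mathcomp Require Import all_classical all_reals all_analysis.
From mathcomp.real_closed Require Import complex.
Import Order.TTheory GRing.Theory Num.Theory.
Import numFieldNormedType.Exports.

Set Implicit Arguments.
Unset Strict Implicit.
Unset Printing Implicit Defensive.

Local Open Scope classical_set_scope.
Local Open Scope ring_scope.
Local Open Scope complex_scope.

Definition cmod {R : realType} (z : R[i]) : R := Normc.normc z.

Definition cis {R : realType} (t : R) : R[i] := cos t +i* sin t.

Definition cint {R : realType} (T : R) (g : R -> R[i]) : R[i] :=
  (\int[lebesgue_measure]_(x in `[0, T]) complex.Re (g x))
  +i* (\int[lebesgue_measure]_(x in `[0, T]) complex.Im (g x)).

Definition omega {R : realType} (T alpha : R) : R := 2 * pi * alpha / T.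

Definition fourier_coef {R : realType} (T : R) (f : R -> R[i]) (k : int)
    : R[i] :=
  (T^-1)%:C * cint T (fun x => f x * cis (- (omega T k%:~R * x))).

Definition square_integrable {R : realType} (T : R) (u : R -> R[i]) : Prop :=
  [/\ measurable_fun `[0, T] (fun x => complex.Re (u x)),
      measurable_fun `[0, T] (fun x => complex.Im (u x)) &
      (lebesgue_measure.-integrable `[0, T]
         (fun x => (cmod (u x) ^+ 2)%:E))].

(* Real test functions suffice: both sides of [weak_derivative] are
   complex-linear in the test function. *)
Definition test_function {R : realType} (T : R) (phi : R -> R) : Prop :=
  (forall n x, derivable (derive1n n phi) x 1) /\
  (exists a b, [/\ 0 < a, a <= b, b < T &
     forall x, ~~ (a <= x <= b) -> phi x = 0]).

Definition weak_derivative {R : realType} (T : R) (j : nat)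
    (u v : R -> R[i]) : Prop :=
  forall phi, test_function T phi ->
    cint T (fun x => u x * (derive1n j phi x)%:C) =
    (-1) ^+ j * cint T (fun x => v x * (phi x)%:C).

Definition cbounded_variation {R : realType} (a b : R) (u : R -> R[i]) : Prop :=
  exists M : R, forall s : seq R, itv_partition a b s ->
    \sum_(p <- zip s (a :: s)) cmod (u p.1 - u p.2) <= M.

(* The second clause says that u is in the Sobolev space H^s([0, T]). The
   derivatives u^(j) are classes modulo equality a.e., and [D] fixes their
   representatives: for [j < s] the continuous one, whose endpoint values are
   meant by u^(j)(0) and u^(j)(T), and for [j = s] one of bounded variation. *)
Definition calH {R : realType} (T : R) (s : nat) (u : R -> R[i]) : Prop :=
  exists D : nat -> R -> R[i],
    [/\ forall x, 0 <= x <= T -> D 0%N x = u x,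
        forall j, (j <= s)%N ->
          square_integrable T (D j) /\ weak_derivative T j u (D j),
        forall j, (j < s)%N ->
          {within `[0, T], continuous (D j : R -> (R[i])^o)} /\ D j 0 = D j T
      & cbounded_variation 0 T (D s)].

Definition calH_infty {R : realType} (T : R) (u : R -> R[i]) : Prop :=
  forall s, calH T s u.

Definition strip {R : realType} (T beta : R) : set R[i] :=
  [set z | 0 <= complex.Re z <= T /\ - beta <= complex.Im z <= beta].

(* [^o] selects the topology of the modulus on the field [R[i]]. *)
Definition analytic_on {R : realType} (U : set R[i]) (F : R[i] -> R[i])
    : Prop :=
  forall z0, U z0 -> exists (r : R) (a : nat -> R[i]), 0 < r /\
    forall z, cmod (z - z0) < r ->
      series (fun n => a n * (z - z0) ^+ n : (R[i])^o) @ \oo --> (F z : (R[i])^o).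

Definition calA {R : realType} (T beta : R) (u : R -> R[i]) : Prop :=
  calH_infty T u /\
  exists (U : set (R[i])^o) (F : R[i] -> R[i]),
    [/\ open U, strip T beta `<=` U, analytic_on U F &
        forall x, 0 <= x <= T -> F x%:C = u x].

(* The filter |k| --> +oo on the integers, for the library's [=O_] *)
Definition abs_pinfty : set_system int :=
  filter_from setT (fun n : nat => [set k : int | (n <= `|k|)%N]).

Global Instance abs_pinfty_filter : ProperFilter abs_pinfty.
Proof.
apply: filter_from_proper.
  apply: filter_from_filter; first by exists 0%N.
  move=> m n _ _; exists (maxn m n) => // k /=.
  by rewrite geq_max => /andP[].
by move=> n _; exists n%:Z => /=.
Qed.

Canonical abs_pinfty_filterType :=
  FilterType abs_pinfty abs_pinfty_filter.

(* Main.v *)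
(* Moving the path of integration from [0, T] to [0, T] + iy with |y| < beta
   gives f^_k = (1/T) int_0^T F(x + iy) exp(- i omega_k (x + iy)) dx, whose
   integrand is O(exp(omega_k y)); letting y tend to -+beta according to the
   sign of k yields the decay. The vertical sides of the contour cancel because
   F(iy) = F(T + iy): the Taylor coefficients of F at 0 and T coincide, since
   the weak derivatives of f are the classical ones by the fundamental lemma
   of the calculus of variations. The integral over the shifted path has zero
   derivative in y: by the Cauchy-Riemann equations, the y-derivative of the
   integrand is the x-derivative of a function with equal values at 0 and T. *)
Require Import Defs.
From mathcomp Require Import all_boot all_order all_algebra.
From mathcomp Require Import all_classical all_reals all_analysis.
From mathcomp.real_closed Require Import complex.
From mathcomp Require Import ring lra.
Import Order.TTheory GRing.Theory Num.Theory.
Import numFieldNormedType.Exports.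

Set Implicit Arguments.
Unset Strict Implicit.
Unset Printing Implicit Defensive.

Local Open Scope classical_set_scope.
Local Open Scope ring_scope.

(** * Convergence in modulus *)

Section cmod.
Context {R : realType}.
Implicit Types (z w h : R[i]) (u v : nat -> R[i]).

(** [F] is known only near the strip and has no periodic extension there, so the equality of the two
    vertical sides has to be carried upwards from the real axis. Equal Taylor coefficients at 0 and
    T give equality only on a common disc of convergence, whose radius may be far smaller than beta.
    What is carried along the segment is therefore the agreement of the derivatives of every order,
    a condition that is both open and closed. The derivative [cderive] is a total function, so
    [iter j cderive F] is defined for every j; near the strip each iterate is again the sum of a
    power series, on the same disc as [F]. Differentiation in y takes place on the open interval |y|
    < beta, whereas compactness of the closed rectangle bounds [F] by one constant for all k and all
    y. This uniformity lets the estimate survive the passage to |y| = beta. Holomorphic functions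
    enter the contour argument as pairs of real functions satisfying [CR]: only the integral of the
    real part is shifted, and multiplication by -i transfers the result to the imaginary part. *)

Lemma cmod_ge0 z : 0 <= cmod z.
Proof. by case: z => a b; exact: sqrtr_ge0. Qed.

Lemma cmodM z w : cmod (z * w) = cmod z * cmod w.
Proof. exact: Normc.normcM. Qed.

Lemma cmodD z w : cmod (z + w) <= cmod z + cmod w.
Proof. exact: le_normcD. Qed.

Lemma cmodN z : cmod (- z) = cmod z.
Proof. exact: normcN. Qed.

Lemma cmodB z w : cmod (z - w) = cmod (w - z).
Proof. by rewrite -cmodN opprB. Qed.

Lemma cmod0 : cmod (0 : R[i]) = 0.
Proof. exact: Normc.normc0. Qed.

Lemma cmodX z n : cmod (z ^+ n) = cmod z ^+ n.
Proof.
elim: n => [|n IH]; first by rewrite !expr0; exact: Normc.normc1.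
by rewrite !exprS cmodM IH.
Qed.

Lemma cmod_real (x : R) : cmod x%:C%C = `|x|.
Proof. by rewrite /cmod /= expr0n /= addr0 sqrtr_sqr. Qed.

Lemma cmodE z : cmod z = Num.sqrt (complex.Re z ^+ 2 + complex.Im z ^+ 2).
Proof. by case: z. Qed.

Lemma normE z : `|z| = (cmod z)%:C%C.
Proof. by []. Qed.

Lemma Re_cmod z : `|complex.Re z| <= cmod z.
Proof.
by rewrite cmodE -sqrtr_sqr ler_sqrt ?lerDl ?addr_ge0 ?sqr_ge0.
Qed.

Lemma Im_cmod z : `|complex.Im z| <= cmod z.
Proof.
by rewrite cmodE -sqrtr_sqr ler_sqrt ?lerDr ?addr_ge0 ?sqr_ge0.
Qed.

Lemma cmod_ReIm z : cmod z <= `|complex.Re z| + `|complex.Im z|.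
Proof.
rewrite cmodE -[leRHS]ger0_norm ?addr_ge0// -sqrtr_sqr ler_sqrt ?sqr_ge0//.
rewrite sqrrD !real_normK ?num_real// -addrA lerD2l lerDr mulrn_wge0//.
Qed.

Lemma cmod_eq0 z : cmod z <= 0 -> z = 0.
Proof.
move=> z0; apply: Normc.eq0_normc; apply/eqP.
by rewrite eq_le z0 cmod_ge0.
Qed.

(** The norm of [R[i]] has values in [R[i]]. Stating convergence with the real-valued [cmod] keeps
    all estimates in the ordered field [R]. *)
Definition ccvg u (l : R[i]) :=
  forall e : R, 0 < e -> exists N, forall n, (N <= n)%N -> cmod (u n - l) < e.

Lemma ccvg_le u l c B : ccvg u l -> (forall n, cmod (u n - c) <= B) ->
  cmod (l - c) <= B.
Proof.
move=> ul uB; apply/ler_addgt0Pr => e /ul [N /(_ N (leqnn N))] He.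
rewrite (_ : l - c = (l - u N) + (u N - c)); last by ring.
by rewrite (le_trans (cmodD _ _))// addrC lerD// cmodB ltW.
Qed.

Lemma ccvg_unique u l l' : ccvg u l -> ccvg u l' -> l = l'.
Proof.
move=> ul ul'; apply/eqP; rewrite -subr_eq0; apply/eqP/cmod_eq0.
apply/ler_addgt0Pr => e e0; rewrite add0r.
have [N HN] := ul _ (divr_gt0 e0 (ltr0Sn _ 1)).
have [N' HN'] := ul' _ (divr_gt0 e0 (ltr0Sn _ 1)).
have h1 := HN _ (leq_maxl N N'); have h2 := HN' _ (leq_maxr N N').
rewrite (_ : l - l' = (l - u (maxn N N')) + (u (maxn N N') - l')); last by ring.
rewrite (le_trans (cmodD _ _))// cmodB [leRHS]splitr.
by rewrite lerD// ltW.
Qed.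

Lemma ccvgD u v l l' : ccvg u l -> ccvg v l' ->
  ccvg (fun n => u n + v n) (l + l').
Proof.
move=> ul vl e e0.
have [N HN] := ul _ (divr_gt0 e0 (ltr0Sn _ 1)).
have [N' HN'] := vl _ (divr_gt0 e0 (ltr0Sn _ 1)).
exists (maxn N N') => n; rewrite geq_max => /andP[/HN h1 /HN' h2].
rewrite (_ : _ - _ = (u n - l) + (v n - l')); last by ring.
by rewrite (le_lt_trans (cmodD _ _))// [ltRHS]splitr ltrD.
Qed.

Lemma ccvgMl c u l : ccvg u l -> ccvg (fun n => c * u n) (c * l).
Proof.
move=> ul e e0.
have c1 : 0 < cmod c + 1 by rewrite ltr_wpDl ?cmod_ge0.
have [N HN] := ul _ (divr_gt0 e0 c1).
exists N => n /HN; rewrite ltr_pdivlMr// => He.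
rewrite -mulrBr cmodM (le_lt_trans _ He)// mulrC ler_wpM2l ?cmod_ge0//.
by rewrite lerDl.
Qed.

Lemma ccvg_bounded_series u l : ccvg (series u) l ->
  exists2 M, 0 <= M & forall n, cmod (u n) <= M.
Proof.
move=> /(_ 1 ltr01)[N HN].
have [M HM] : exists M, forall n, (n < N)%N -> cmod (u n) <= M.
  elim: N {HN} => [|N [M HM]]; first by exists 0.
  exists (Num.max M (cmod (u N))) => n; rewrite ltnS leq_eqVlt.
  move=> /predU1P[->|/HM h]; first by rewrite le_max lexx orbT.
  by rewrite le_max h.
(* From N on, a term is the difference of two partial sums, each within 1 of [l]. *)
exists (Num.max 2 M); first by rewrite le_max ler0n.
move=> n; rewrite le_max; case: (ltnP n N) => [/HM ->|Nn]; first by rewrite orbT.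
have -> : u n = (series u n.+1 - l) + (l - series u n).
  by rewrite /series /= big_nat_recr//=; ring.
rewrite (le_trans (cmodD _ _))// (_ : 2 = 1 + 1)//.
by rewrite lerD ?ltW// 1?[cmod (l - _)]cmodB HN// (leq_trans Nn).
Qed.

(** The real and imaginary parts are dominated by the modulus, so each gives an absolutely
    convergent real series. *)
Lemma ccvg_abs u (B : R) : (forall n, \sum_(0 <= k < n) cmod (u k) <= B) ->
  exists l, ccvg (series u) l.
Proof.
move=> uB.
have key (p : R[i] -> R) : (forall z, `|p z| <= cmod z) ->
    cvgn (series (fun n => p (u n))).
  move=> pz; apply: normed_cvg; apply: nondecreasing_is_cvgn.
    by apply: nondecreasing_series => n _ _; rewrite normr_ge0.
  exists B => _ [n _ <-]; rewrite (le_trans _ (uB n))//.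
  by apply: ler_sum => k _; exact: pz.
have /cvg_ex[/= a /cvgrPdist_lt ca] := key _ Re_cmod.
have /cvg_ex[/= b /cvgrPdist_lt cb] := key _ Im_cmod.
exists (a +i* b)%C => e e0.
have [N _ HN] := ca _ (divr_gt0 e0 (ltr0Sn _ 1)).
have [N' _ HN'] := cb _ (divr_gt0 e0 (ltr0Sn _ 1)).
exists (maxn N N') => n; rewrite geq_max => /andP[/HN /= h1 /HN' /= h2].
rewrite (le_lt_trans (cmod_ReIm _))// [ltRHS]splitr.
have serE (p : R[i] -> R) : {morph p : x y / x + y} -> p 0 = 0 ->
    p (series u n) = series (fun n => p (u n)) n.
  by move=> pD p0; rewrite /series/= (big_morph p pD p0).
have ReD : {morph (@complex.Re R) : x y / x + y} by move=> [? ?] [? ?].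
have ImD : {morph (@complex.Im R) : x y / x + y} by move=> [? ?] [? ?].
rewrite ReD ImD (serE _ ReD)// (serE _ ImD)//= ltrD// distrC//.
Qed.

End cmod.

(** * Power series *)

Section power_series.
Context {R : realType}.
Implicit Types (z w h : R[i]) (F G : R[i] -> R[i]) (a : nat -> R[i]).

(** The factor [s] on the left avoids both the exponent n - 1 and a division by [s]. *)
Lemma pow_diff1 (s : R) v w n : 0 <= s -> cmod v <= s -> cmod w <= s ->
  s * cmod (v ^+ n - w ^+ n) <= n%:R * s ^+ n * cmod (v - w).
Proof.
move=> s0 vs ws; elim: n => [|n IH]; first by rewrite !expr0 subrr cmod0; lra.
rewrite (_ : v ^+ n.+1 - w ^+ n.+1 = v * (v ^+ n - w ^+ n) + w ^+ n * (v - w));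
  last by rewrite !exprS; ring.
apply: le_trans (_ : s * (s * cmod (v ^+ n - w ^+ n) + s ^+ n * cmod (v - w)) <= _).
  rewrite ler_wpM2l// (le_trans (cmodD _ _))// !cmodM lerD// ler_wpM2r ?cmod_ge0//.
  by rewrite cmodX lerXn2r ?nnegrE ?cmod_ge0.
rewrite -natr1 exprS.
have : s * (s * cmod (v ^+ n - w ^+ n)) <= s * (n%:R * s ^+ n * cmod (v - w)).
  by rewrite ler_wpM2l.
by move: (s ^+ n) (cmod _) (cmod _) => p x y; lra.
Qed.

(** The remainders satisfy R_(n+1) = w R_n + h ((w + h)^n - w^n), and [pow_diff1] bounds the last
    factor. The induction closes because n^2 + n <= (n + 1)^2. *)
Lemma pow_diff2 (s : R) w h n : 0 <= s -> cmod (w + h) <= s -> cmod w <= s ->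
  s ^+ 2 * cmod ((w + h) ^+ n - w ^+ n - n%:R * w ^+ n.-1 * h)
    <= n%:R ^+ 2 * s ^+ n * cmod h ^+ 2.
Proof.
move=> s0 vs ws; elim: n => [|n IH].
  by rewrite !expr0 subrr !mul0r subrr cmod0; lra.
have -> : (w + h) ^+ n.+1 - w ^+ n.+1 - n.+1%:R * w ^+ n.+1.-1 * h =
    w * ((w + h) ^+ n - w ^+ n - n%:R * w ^+ n.-1 * h)
    + h * ((w + h) ^+ n - w ^+ n).
  by case: n {IH} => [|n] /=; rewrite -!natr1 ?expr0 !exprS; ring.
set A := (w + h) ^+ n - w ^+ n - _ in IH *; set B := (w + h) ^+ n - w ^+ n.
have HB : s * cmod B <= n%:R * s ^+ n * cmod h.
  by have := pow_diff1 n s0 vs ws; rewrite (_ : w + h - w = h)//; ring.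
have s20 : 0 <= s ^+ 2 by exact: sqr_ge0.
apply: le_trans (_ : s ^+ 2 * (s * cmod A + cmod h * cmod B) <= _).
  by rewrite ler_wpM2l// (le_trans (cmodD _ _))// !cmodM lerD// ler_wpM2r ?cmod_ge0.
have h1 : s * (s ^+ 2 * cmod A) <= s * (n%:R ^+ 2 * s ^+ n * cmod h ^+ 2).
  by rewrite ler_wpM2l.
have h2 : (s * cmod h) * (s * cmod B) <= (s * cmod h) * (n%:R * s ^+ n * cmod h).
  by rewrite ler_wpM2l// mulr_ge0// cmod_ge0.
have h3 : 0 <= (n%:R + 1) * (s * s ^+ n * cmod h ^+ 2).
  by rewrite !mulr_ge0 ?exprn_ge0 ?cmod_ge0// addr_ge0.
rewrite -natr1 [s ^+ n.+1]exprS; move: h1 h2 h3.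
move: (s ^+ n) (cmod A) (cmod B) (cmod h) (n%:R) => p x y c m; rewrite !expr2; lra.
Qed.

Lemma sum_sqr_geometric (q : R) : 0 <= q -> q < 1 ->
  exists2 B, 0 <= B & forall n, \sum_(0 <= k < n) k%:R ^+ 2 * q ^+ k <= B.
Proof.
move=> q0 q1.
(* Bernoulli's inequality gives (k x)^2 <= (1 + x)^(2k), so the terms are at most x^-2 p^k with p =
   (1 + x)^2 q. The choice of x makes p = 1 - 2x - 7x^2 - 4x^3 < 1. *)
have [x x0 qx] : exists2 x : R, 0 < x & q = 1 - 4 * x.
  by exists ((1 - q) / 4); lra.
pose p := (1 + x) ^+ 2 * q.
have p0 : 0 <= p by rewrite mulr_ge0// sqr_ge0.
have p1 : p < 1 by rewrite /p qx; nra.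
have term k : k%:R ^+ 2 * q ^+ k <= x ^- 2 * p ^+ k.
  rewrite /p exprMn [leRHS]mulrA ler_wpM2r ?exprn_ge0//.
  rewrite ler_pdivlMl ?exprn_gt0// -exprMn -exprM mulnC exprM.
  have xk0 : 0 <= x * k%:R by rewrite mulr_ge0 ?(ltW x0).
  have xk1 : 0 <= (1 + x) ^+ k by rewrite exprn_ge0// addr_ge0 ?(ltW x0).
  rewrite lerXn2r//; suff : 1 + x * k%:R <= (1 + x) ^+ k by lra.
  elim: {xk0 xk1} k => [|k IH]; first by rewrite mulr0 expr0 addr0.
  rewrite exprS; apply: le_trans (_ : (1 + x) * (1 + x * k%:R) <= _).
    have : 0 <= x ^+ 2 * k%:R by rewrite mulr_ge0 ?sqr_ge0.
    by rewrite -natr1 expr2; lra.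
  by rewrite ler_wpM2l// addr_ge0 ?(ltW x0).
exists (x ^- 2 * (1 - p)^-1) => [|n].
  by rewrite mulr_ge0 ?invr_ge0 ?exprn_ge0 ?(ltW x0)// subr_ge0 ltW.
apply: le_trans (_ : \sum_(0 <= k < n) x ^- 2 * p ^+ k <= _).
  by apply: ler_sum => k _.
rewrite -mulr_sumr ler_wpM2l ?invr_ge0 ?exprn_ge0 ?(ltW x0)//.
have p1' : 0 < 1 - p by rewrite subr_gt0.
rewrite -[leRHS]mul1r ler_pdivlMr//.
have -> : (\sum_(0 <= i < n) p ^+ i) * (1 - p) = 1 - p ^+ n.
  elim: n => [|n IH]; first by rewrite big_geq// mul0r expr0 subrr.
  by rewrite big_nat_recr//= mulrDl IH exprS; ring.
by rewrite gerBl exprn_ge0.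
Qed.

(* The quadratic remainder is what power series provide; it makes the passage
   to real partial derivatives free of limits. *)
Definition is_cderive F z d := exists2 e : R, 0 < e & exists C : R,
  forall h, cmod h < e -> cmod (F (z + h) - F z - d * h) <= C * cmod h ^+ 2.

Definition dseq a n := n.+1%:R * a n.+1.

Definition has_ps F z0 (r : R) a := 0 < r /\
  forall h, cmod h < r -> ccvg (series (fun n => a n * h ^+ n)) (F (z0 + h)).

Lemma ccvg_shift (u : nat -> R[i]) l :
  ccvg u l -> ccvg (fun n => u n.+1) l.
Proof.
by move=> ul e /ul[N HN]; exists N => n Nn; apply: HN; rewrite leqW.
Qed.

(** Termwise differentiation at an arbitrary point of the disc, not only at its centre: this is why
    [cderive F] keeps the radius [r] and the result can be iterated. *)
Lemma has_ps_deriv F z0 r a h : has_ps F z0 r a -> cmod h < r ->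
  exists2 d, is_cderive F (z0 + h) d & ccvg (series (fun n => dseq a n * h ^+ n)) d.
Proof.
move=> [r0 Fa] hr.
(* Two intermediate radii |h| < s < rho < r. Convergence at [rho] bounds the terms there, so at [s]
   they decay like (s / rho)^n; the gap s - |h| is the room left for the increment [g]. *)
pose s := cmod h + (r - cmod h) / 3; pose rho := cmod h + (r - cmod h) / 3 * 2.
have h0 := cmod_ge0 h.
have hs : cmod h < s by rewrite /s; lra.
have srho : s < rho by rewrite /s /rho; lra.
have rhor : rho < r by rewrite /rho; lra.
have s0 : 0 < s by exact: le_lt_trans hs.
have rho0 : 0 < rho by exact: lt_trans srho.
have crho : cmod rho%:C%C = rho by rewrite cmod_real gtr0_norm.
have [M M0 HM] : exists2 M, 0 <= M & forall n, cmod (a n) * rho ^+ n <= M.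
  have [|M M0 HM] := @ccvg_bounded_series _ _ _ (Fa rho%:C%C _).
    by rewrite crho.
  by exists M => // n; have := HM n; rewrite cmodM cmodX crho.
pose q := s / rho.
have q0 : 0 <= q by rewrite divr_ge0 ?ltW.
have q1 : q < 1 by rewrite ltr_pdivrMr ?mul1r.
have as_le n : cmod (a n) * s ^+ n <= M * q ^+ n.
  rewrite /q expr_div_n mulrA ler_pdivlMr ?exprn_gt0// mulrAC.
  by rewrite ler_wpM2r ?exprn_ge0 ?(ltW s0).
have [B B0 HB] := sum_sqr_geometric q0 q1.
have [d Hd] : exists d, ccvg (series (fun n => n%:R * a n * h ^+ n.-1)) d.
  apply: (@ccvg_abs _ _ (s^-1 * (M * B))) => n.
  rewrite ler_pdivlMl// mulr_sumr.
  apply: le_trans (ler_wpM2l M0 (HB n)); rewrite mulr_sumr.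
  apply: ler_sum => k _; rewrite !cmodM cmodX.
  have -> : cmod (k%:R : R[i]) = k%:R.
    by rewrite -[k%:R in LHS](rmorph_nat (real_complex R)) cmod_real normr_nat.
  case: k => [|k]; first by rewrite !(mul0r, mulr0, expr0n).
  rewrite /= [leRHS]mulrCA.
  apply: le_trans (_ : k.+1%:R ^+ 2 * (cmod (a k.+1) * s ^+ k.+1) <= _); last first.
    by rewrite ler_wpM2l ?sqr_ge0.
  rewrite expr2 -!mulrA mulrCA ler_wpM2l// mulrCA [leRHS]mulrCA ler_wpM2l ?cmod_ge0//.
  rewrite exprS mulrCA ler_wpM2l ?(ltW s0)//.
  apply: le_trans (_ : s ^+ k <= _).
    by rewrite lerXn2r ?nnegrE ?(ltW s0)// ltW.
  by rewrite ler_peMl ?exprn_ge0 ?(ltW s0)// ler1n.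
(* The term of index 0 vanishes thanks to its factor n, whatever [n.-1] means there; dropping it
   gives the coefficients [dseq a]. *)
exists d; last first.
  move=> e /(ccvg_shift Hd)[N HN]; exists N => n /HN.
  by rewrite /series /= big_nat_recl//= !mul0r add0r.
exists (s - cmod h); first by rewrite subr_gt0.
exists (s ^- 2 * (M * B)) => g gs.
have hg : cmod (h + g) <= s by rewrite (le_trans (cmodD _ _))//; lra.
have hgr : cmod (h + g) < r by rewrite (le_lt_trans hg)// (lt_trans srho).
have F1 := Fa _ hgr; have F2 := Fa _ hr.
(* The Taylor remainder of [F] is the limit of sums of the remainders of the monomials, so a bound
   uniform in n passes to it. *)
have := ccvgD (ccvgD F1 (ccvgMl (-1) F2)) (ccvgMl (- g) Hd).
rewrite mulN1r mulNr [g * d]mulrC addrA => cv.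
rewrite -[X in cmod X]subr0; apply: (ccvg_le cv) => n.
rewrite subr0 /series /= !mulr_sumr -!big_split/=.
apply: (le_trans (_ : _ <= \sum_(0 <= k < n)
    s ^- 2 * (M * (k%:R ^+ 2 * q ^+ k)) * cmod g ^+ 2)); last first.
  rewrite -mulr_suml -!mulr_sumr ler_wpM2r ?sqr_ge0// ler_wpM2l ?invr_ge0 ?sqr_ge0//.
  exact: ler_wpM2l.
apply: le_trans (_ : \sum_(0 <= k < n) cmod (a k) *
    cmod ((h + g) ^+ k - h ^+ k - k%:R * h ^+ k.-1 * g) <= _).
  elim/big_ind2 : _ => [|x y x' y' xy xy'|k _].
  - by rewrite cmod0.
  - by rewrite (le_trans (cmodD _ _)) ?lerD.
  - by rewrite -cmodM le_eqVlt; apply/predU1P; left; congr cmod; ring.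
apply: ler_sum => k _.
rewrite -[leRHS]mulrA ler_pdivlMl ?exprn_gt0// mulrCA.
apply: le_trans (ler_wpM2l (cmod_ge0 _) (pow_diff2 k (ltW s0) hg (ltW hs))) _.
have := ler_wpM2r (sqr_ge0 (cmod g)) (ler_wpM2l (sqr_ge0 k%:R) (as_le k)).
by congr (_ <= _); ring.
Qed.

Lemma is_cderive_unique F z d d' : is_cderive F z d -> is_cderive F z d' -> d = d'.
Proof.
move=> [e e0 [C HC]] [e' e0' [C' HC']].
apply/eqP; rewrite -subr_eq0; apply/eqP/cmod_eq0.
apply/ler_addgt0Pr => t t0; rewrite add0r.
pose K := `|C| + `|C'| + 1.
have K0 : 0 < K by rewrite ltr_wpDl ?addr_ge0.
(* A real increment m gives |d - d'| <= K m. Both estimates apply for m < e, e', and m < t / K makes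
   the bound smaller than the given t; halving makes these inequalities strict. *)
pose m := Num.min (Num.min e e') (t / K) / 2.
have tK : 0 < t / K by rewrite divr_gt0.
have m0 : 0 < m by rewrite divr_gt0// !lt_min e0 e0' tK.
have mlt : m < Num.min (Num.min e e') (t / K).
  by rewrite /m ltr_pdivrMr// ltr_pMr ?ltr1n// !lt_min e0 e0' tK.
move: mlt; rewrite !lt_min => /andP[/andP[me me'] mt].
have cm : cmod m%:C%C = m by rewrite cmod_real gtr0_norm.
have := HC m%:C%C; rewrite cm => /(_ me) h1.
have := HC' m%:C%C; rewrite cm => /(_ me') h2.
have : cmod ((d - d') * m%:C%C) <= C * m ^+ 2 + C' * m ^+ 2.
  rewrite (_ : (d - d') * _ = - (F (z + m%:C%C) - F z - d * m%:C%C) +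
     (F (z + m%:C%C) - F z - d' * m%:C%C)); last by ring.
  by rewrite (le_trans (cmodD _ _))// cmodN lerD.
rewrite cmodM cm -mulrDl expr2 [leRHS]mulrA ler_pM2r// => /le_trans; apply.
apply: le_trans (_ : K * m <= _); last first.
  by rewrite mulrC -ler_pdivlMr// ltW.
rewrite ler_wpM2r ?(ltW m0)// /K.
have := ler_norm C; have := ler_norm C'; lra.
Qed.

(* [0] where [F] has no derivative. *)
Definition cderive F z : R[i] := xget 0 [set d | is_cderive F z d].

Lemma cderiveE F z d : is_cderive F z d -> cderive F z = d.
Proof.
move=> Fd; rewrite /cderive; case: xgetP => [d' _ /= H|/(_ d)//].
exact: is_cderive_unique H Fd.
Qed.

Lemma has_ps_cderive F z0 r a : has_ps F z0 r a -> has_ps (cderive F) z0 r (dseq a).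
Proof.
move=> Fa; have [r0 _] := Fa; split => // h hr.
by have [d /cderiveE ->] := has_ps_deriv Fa hr.
Qed.

Lemma has_ps_iter F z0 r a j : has_ps F z0 r a ->
  has_ps (iter j cderive F) z0 r (iter j dseq a).
Proof. by move=> Fa; elim: j => //= j; exact: has_ps_cderive. Qed.

Lemma has_ps_is_cderive F z0 r a : has_ps F z0 r a -> is_cderive F z0 (cderive F z0).
Proof.
move=> Fa; have [r0 _] := Fa.
have [|d] := has_ps_deriv (h := 0) Fa; first by rewrite cmod0.
by rewrite addr0 => Hd _; rewrite (cderiveE Hd).
Qed.

Lemma has_ps0 F z0 r a : has_ps F z0 r a -> F z0 = a 0%N.
Proof.
move=> [r0 /(_ 0)]; rewrite cmod0 addr0 => /(_ r0) Fa.
apply: (ccvg_unique Fa) => e e0; exists 1%N => n n0.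
rewrite /series/= big_ltn//= expr0 mulr1 big_nat_cond big1 ?addr0 ?subrr ?cmod0//.
by move=> [|k]// _; rewrite expr0n mulr0.
Qed.

(** The numbers compared are j! a_j and j! b_j. Induction on the index cancels one factor at a time,
    so no factorial has to appear. *)
Lemma dseq_inj a b : (forall j, iter j dseq a 0%N = iter j dseq b 0%N) -> a =1 b.
Proof.
move=> ab n; elim: n a b ab => [a b /(_ 0%N)//|n IH a b ab].
have := IH (dseq a) (dseq b) _; rewrite /dseq => H.
apply: (@mulfI _ n.+1%:R); first by rewrite pnatr_eq0.
by apply: H => j; have := ab j.+1; rewrite !iterSr.
Qed.

(** The derivatives at the centres determine the coefficients, so both expansions are the same
    series. This gives the openness used to move up the vertical sides. *)
Lemma has_ps_germ F z0 z1 r r' a b : has_ps F z0 r a -> has_ps F z1 r' b ->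
  (forall j, iter j cderive F z0 = iter j cderive F z1) ->
  forall j h, cmod h < Num.min r r' ->
    iter j cderive F (z0 + h) = iter j cderive F (z1 + h).
Proof.
move=> Fa Fb FF j h; rewrite lt_min => /andP[hr hr'].
have ab : a = b.
  apply/funext; apply: dseq_inj => i.
  rewrite -(has_ps0 (has_ps_iter i Fa)).
  by rewrite -(has_ps0 (has_ps_iter i Fb)).
have [_ /(_ h hr) H1] := has_ps_iter j Fa.
have [_ /(_ h hr') H2] := has_ps_iter j Fb.
by rewrite -ab in H2; exact: ccvg_unique H1 H2.
Qed.

Lemma analytic_has_ps (U : set R[i]) F z0 : analytic_on U F -> U z0 ->
  exists r a, has_ps F z0 r a.
Proof.
move=> FU /FU[r [a [r0 Fa]]]; exists r, a; split => // h hr.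
have := Fa (z0 + h); rewrite (_ : z0 + h - z0 = h); last by ring.
move=> /(_ hr) /cvgrPdist_lt H e e0.
have [|N _ HN] := H e%:C%C; first by rewrite ltcR.
by exists N => n /HN; rewrite normE ltcR cmodB.
Qed.

End power_series.

(** * Cauchy-Riemann equations *)

Section real_imaginary_parts.
Context {R : realType}.
Implicit Types (z w d : R[i]) (F G : R[i] -> R[i]).

(** The difference quotient is within C |h| of [d]. Besides the partial derivatives, this also
    settles the differentiability of [hbump] at 0. *)
Lemma is_derive_quad (f : R -> R) (t d e C : R) : 0 < e ->
  (forall h, `|h| < e -> `|f (t + h) - f t - d * h| <= C * h ^+ 2) ->
  is_derive t (1 : R) f d.
Proof.
move=> e0 H.
have cv : (fun h => h^-1 *: ((f \o shift t) (h *: (1 : R)) - f t)) @ 0^' --> d.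
  apply/cvgrPdist_le => /= eps eps0.
  have C1 : 0 < `|C| + 1 by rewrite ltr_wpDl.
  near=> h.
  have h0 : h != 0 by near: h; exact: nbhs_dnbhs_neq.
  have he : `|h| < e by near: h; apply: dnbhs0_lt.
  have hC : `|h| < eps / (`|C| + 1) by near: h; apply: dnbhs0_lt; exact: divr_gt0.
  have h0' : 0 < `|h| by rewrite normr_gt0.
  have := H _ he.
  rewrite /= scaler1 (addrC h t) -real_normK ?num_real// => Hh.
  rewrite -(ler_pM2r h0') -normrM mulrBl.
  rewrite [_ *: _ * h](_ : _ = f (t + h) - f t); last first.
    by rewrite /GRing.scale/= mulrC mulrA mulfV// mul1r.
  rewrite distrC (le_trans Hh)// expr2 mulrA ler_wpM2r//.
  move: hC; rewrite ltr_pdivlMr// => /ltW; apply: le_trans.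
  rewrite mulrC ler_wpM2l//; have := ler_norm C; lra.
have dv : derivable f t 1 by apply/cvg_ex; exists d.
by apply: DeriveDef => //; apply: cvg_lim.
Unshelve. all: end_near. Qed.

Lemma ReB z w : complex.Re (z - w) = complex.Re z - complex.Re w.
Proof. by case: z w => [? ?] [? ?]. Qed.

Lemma ImB z w : complex.Im (z - w) = complex.Im z - complex.Im w.
Proof. by case: z w => [? ?] [? ?]. Qed.

Definition ReF F (x y : R) := complex.Re (F (x +i* y)%C).
Definition ImF F (x y : R) := complex.Im (F (x +i* y)%C).

Lemma is_cderive_partials F x y d : is_cderive F (x +i* y)%C d ->
  [/\ is_derive x (1 : R) (ReF F ^~ y) (complex.Re d),
      is_derive x (1 : R) (ImF F ^~ y) (complex.Im d),
      is_derive y (1 : R) (ReF F x) (- complex.Im d) &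
      is_derive y (1 : R) (ImF F x) (complex.Re d)].
Proof.
move=> [e e0 [C HC]].
have cx (h : R) : cmod (h +i* 0)%C = `|h| by exact: cmod_real.
have cy (h : R) : cmod (0 +i* h)%C = `|h|.
  by rewrite /cmod/= expr0n/= add0r sqrtr_sqr.
have Hx h : `|h| < e ->
    cmod (F ((x + h) +i* y)%C - F (x +i* y)%C - d * (h +i* 0)%C) <= C * h ^+ 2.
  move=> he; have := HC (h +i* 0)%C; rewrite cx => /(_ he).
  by rewrite real_normK ?num_real//; congr (cmod (F _ - _ - _) <= _); simpc.
have Hy h : `|h| < e ->
    cmod (F (x +i* (y + h))%C - F (x +i* y)%C - d * (0 +i* h)%C) <= C * h ^+ 2.
  move=> he; have := HC (0 +i* h)%C; rewrite cy => /(_ he).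
  by rewrite real_normK ?num_real//; congr (cmod (F _ - _ - _) <= _); simpc.
split; apply: (is_derive_quad (C := C) e0) => h he.
- apply: le_trans (Hx h he); apply: le_trans (Re_cmod _); rewrite !ReB.
  by case: d {HC Hx Hy} => a b /=; rewrite mulr0 subr0.
- apply: le_trans (Hx h he); apply: le_trans (Im_cmod _); rewrite !ImB.
  by case: d {HC Hx Hy} => a b /=; rewrite mulr0 add0r.
- apply: le_trans (Hy h he); apply: le_trans (Re_cmod _); rewrite !ReB.
  by case: d {HC Hx Hy} => a b /=; rewrite mulr0 sub0r mulNr.
- apply: le_trans (Hy h he); apply: le_trans (Im_cmod _); rewrite !ImB.
  by case: d {HC Hx Hy} => a b /=; rewrite mulr0 addr0.
Qed.

Definition jcont (a : R -> R -> R) (x y : R) :=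
  {for (x, y), continuous (fun p : R * R => a p.1 p.2)}.

Lemma is_cderive_jcont F x y d : is_cderive F (x +i* y)%C d ->
  jcont (ReF F) x y /\ jcont (ImF F) x y.
Proof.
move=> [e e0 [C HC]].
(* For |h| < min(e, 1) the quadratic term is at most |C| |h|, so [F] is Lipschitz at the point; the
   1 only keeps [K] positive for the division. *)
pose K := cmod d + `|C| + 1.
have K0 : 0 < K by rewrite ltr_wpDl// addr_ge0// cmod_ge0.
have lip h : cmod h < Num.min e 1 ->
    cmod (F ((x +i* y)%C + h) - F (x +i* y)%C) <= K * cmod h.
  rewrite lt_min => /andP[he h1].
  have := HC _ he; set D := F _ - F _ => HD.
  have -> : D = (D - d * h) + d * h by ring.
  rewrite (le_trans (cmodD _ _))// cmodM.
  have h0 := cmod_ge0 h.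
  have : C * cmod h ^+ 2 <= `|C| * cmod h.
    apply: le_trans (_ : `|C| * cmod h ^+ 2 <= _).
      by rewrite ler_wpM2r ?sqr_ge0 ?ler_norm.
    by rewrite ler_wpM2l// expr2 ler_piMl// ltW.
  rewrite /K; lra.
have key (p : R[i] -> R) : (forall z, `|p z| <= cmod z) ->
    (forall z w, p (z - w) = p z - p w) -> jcont (fun x y => p (F (x +i* y)%C)) x y.
  move=> pc pB; apply/cvgrPdist_le => /= eps eps0.
  pose dl := Num.min (Num.min e 1) (eps / K).
  have dl0 : 0 < dl by rewrite !lt_min e0 ltr01 divr_gt0.
  have dl20 : 0 < dl / 2 by rewrite divr_gt0.
  near=> q.
  have q1 : `|x - q.1| < dl / 2.
    near: q; have /cvgrPdist_lt : fst p @[p --> (x, y)] --> x by exact: cvg_fst.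
    by apply.
  have q2 : `|y - q.2| < dl / 2.
    near: q; have /cvgrPdist_lt : snd p @[p --> (x, y)] --> y by exact: cvg_snd.
    by apply.
  rewrite -pB (le_trans (pc _))// cmodB.
  pose h := ((q.1 - x) +i* (q.2 - y))%C.
  have -> : (q.1 +i* q.2)%C = (x +i* y)%C + h.
    by rewrite /h; simpc; congr (_ +i* _)%C; ring.
  have : cmod h < dl.
    by rewrite (le_lt_trans (cmod_ReIm _))//= [ltRHS]splitr distrC (distrC q.2) ltrD.
  rewrite lt_min => /andP[h1 h2].
  by rewrite (le_trans (lip _ h1))// mulrC -ler_pdivlMr// ltW.
by split; apply: key => //; [exact: Re_cmod|exact: ReB|exact: Im_cmod|exact: ImB].
Unshelve. all: end_near. Qed.

(* The Cauchy-Riemann equations for [a + i b], with [ax], [bx] the partial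
   derivatives with respect to [x]. *)
Definition CR (a b ax bx : R -> R -> R) (x y : R) : Prop :=
  [/\ is_derive x (1 : R) (a ^~ y) (ax x y),
      is_derive x (1 : R) (b ^~ y) (bx x y),
      is_derive y (1 : R) (a x) (- bx x y) &
      is_derive y (1 : R) (b x) (ax x y)] /\
  [/\ jcont a x y, jcont b x y, jcont ax x y & jcont bx x y].

(** The second derivative provides the joint continuity of the first partial derivatives. *)
Lemma CR_is_cderive F x y d : is_cderive F (x +i* y)%C (cderive F (x +i* y)%C) ->
  is_cderive (cderive F) (x +i* y)%C d ->
  CR (ReF F) (ImF F) (ReF (cderive F)) (ImF (cderive F)) x y.
Proof.
move=> F1 F2; split; first exact: is_cderive_partials.
have [? ?] := is_cderive_jcont F1; have [? ?] := is_cderive_jcont F2.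
by split.
Qed.

Lemma jcontM a b x y : jcont a x y -> jcont b x y ->
  jcont (fun x y => a x y * b x y) x y.
Proof. by move=> ca cb; apply: continuousM. Qed.

Lemma jcontD a b x y : jcont a x y -> jcont b x y ->
  jcont (fun x y => a x y + b x y) x y.
Proof. by move=> ca cb; apply: continuousD. Qed.

Lemma jcontN a x y : jcont a x y -> jcont (fun x y => - a x y) x y.
Proof. by move=> ca; apply: continuousN. Qed.

(** Multiplication by -i: -i (a + i b) = b - i a. It turns statements about real parts into
    statements about imaginary parts. *)
Lemma CR_rot a b ax bx x y : CR a b ax bx x y ->
  CR b (fun x y => - a x y) bx (fun x y => - ax x y) x y.
Proof.
move=> [[ax' bx' ay by'] [ca cb cax cbx]].
split; last by split => //; exact: jcontN.
split => //.
- exact: is_deriveN.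
- by rewrite opprK.
- by rewrite -[bx x y]opprK; exact: is_deriveN.
Qed.

Lemma CR_mul (a b ax bx c d cx dx : R -> R -> R) x y :
  CR a b ax bx x y -> CR c d cx dx x y ->
  CR (fun x y => a x y * c x y - b x y * d x y)
     (fun x y => a x y * d x y + b x y * c x y)
     (fun x y => (a x y * cx x y - b x y * dx x y)
               + (ax x y * c x y - bx x y * d x y))
     (fun x y => (a x y * dx x y + b x y * cx x y)
               + (ax x y * d x y + bx x y * c x y)) x y.
Proof.
move=> [[ax' bx' ay by'] [ca cb cax cbx]] [[cx' dx' cy dy] [cc cd ccx cdx]].
split; split.
- by apply: is_derive_eq; rewrite /GRing.scale/=; ring.
- by apply: is_derive_eq; rewrite /GRing.scale/=; ring.
- by apply: is_derive_eq; rewrite /GRing.scale/=; ring.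
- by apply: is_derive_eq; rewrite /GRing.scale/=; ring.
- by apply: jcontD; [|apply: jcontN]; exact: jcontM.
- by apply: jcontD; exact: jcontM.
- apply: jcontD; (apply: jcontD; last apply: jcontN); exact: jcontM.
- apply: jcontD; apply: jcontD; exact: jcontM.
Qed.

(* Real and imaginary parts of [exp (- i w (x + i y))]. *)
Lemma CR_exp (w x y : R) :
  CR (fun x y => expR (w * y) * cos (w * x))
     (fun x y => - (expR (w * y) * sin (w * x)))
     (fun x y => - (w * (expR (w * y) * sin (w * x))))
     (fun x y => - (w * (expR (w * y) * cos (w * x)))) x y.
Proof.
have cx : jcont (fun x y => expR (w * y)) x y.
  apply: (@continuous_comp _ _ _ (fun p : R * R => w * p.2) expR
     _ _ (@continuous_expR R _)).
  by apply: continuousM; [exact: cvg_cst|exact: cvg_snd].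
have cc : jcont (fun x y => cos (w * x)) x y.
  apply: (@continuous_comp _ _ _ (fun p : R * R => w * p.1) cos
     _ _ (@continuous_cos R _)).
  by apply: continuousM; [exact: cvg_cst|exact: cvg_fst].
have cs : jcont (fun x y => sin (w * x)) x y.
  apply: (@continuous_comp _ _ _ (fun p : R * R => w * p.1) sin
     _ _ (@continuous_sin R _)).
  by apply: continuousM; [exact: cvg_cst|exact: cvg_fst].
have cw : jcont (fun x y => w) x y by exact: cvg_cst.
split; split.
- by apply: is_derive_eq; rewrite /GRing.scale/=; ring.
- by apply: is_derive_eq; rewrite /GRing.scale/=; ring.
- by apply: is_derive_eq; rewrite /GRing.scale/=; ring.
- by apply: is_derive_eq; rewrite /GRing.scale/=; ring.
- exact: jcontM.
- by apply: jcontN; exact: jcontM.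
- by apply: jcontN; apply: jcontM => //; exact: jcontM.
- by apply: jcontN; apply: jcontM => //; exact: jcontM.
Qed.

End real_imaginary_parts.

(** * Shift of the contour *)

Section contour_shift.
Context {R : realType}.
Local Notation mu := (@lebesgue_measure R).

Lemma derive0_oo_cst (g : R -> R) (b : R) :
  (forall y, y \in `](- b), b[ -> is_derive y (1 : R) g 0) ->
  forall y, y \in `](- b), b[ -> g y = g 0.
Proof.
move=> dg y yb.
have key u v : u <= v -> u \in `](- b), b[ -> v \in `](- b), b[ -> g v - g u = 0.
  move=> uv ub vb.
  have sub t : t \in `[u, v] -> t \in `](- b), b[.
    move: ub vb; rewrite !in_itv/= => /andP[? ?] /andP[? ?] /andP[? ?].
    by apply/andP; split; lra.
  have dgs t : t \in `]u, v[ -> is_derive t (1 : R) g ((cst 0 : R -> R) t).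
    by move=> /subset_itv_oo_cc /sub; exact: dg.
  have cg : {within `[u, v], continuous g}.
    by apply: derivable_within_continuous => t /sub /dg [].
  have [t _ ->] := @MVT_segment R g (cst 0) u v uv dgs cg.
  by rewrite mul0r.
have zb : 0 \in `](- b), b[.
  by move: yb; rewrite !in_itv/= => /andP[? ?]; apply/andP; split; lra.
case: (leP y 0) => [y0|/ltW y0]; last first.
  by have /eqP := key _ _ y0 zb yb; rewrite subr_eq0 => /eqP.
by have /eqP := key _ _ y0 yb zb; rewrite subr_eq0 => /eqP.
Qed.

Lemma jcont_bounded (a : R -> R -> R) (T b : R) : 0 <= T -> 0 <= b ->
  (forall x y, 0 <= x <= T -> - b <= y <= b -> jcont a x y) ->
  exists M : R, forall x y, 0 <= x <= T -> - b <= y <= b -> `|a x y| <= M.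
Proof.
move=> T0 b0 ca.
pose A : set (R * R) := `[0, T] `*` `[- b, b].
have cA : compact A by apply: compact_setX; exact: segment_compact.
have A0 : A !=set0.
  by exists (0, 0); split; rewrite /= in_itv/=; apply/andP; split; lra.
have [|[x y] _ H] := @compact_EVT_max _ _ (fun p : R * R => `|a p.1 p.2|) A A0 cA.
  apply: continuous_in_subspaceT => -[x y]; rewrite inE => -[/=].
  rewrite !in_itv/= => xT yb.
  by apply: cvg_norm; exact: ca.
exists `|a x y| => u v uT vb; apply: (H (u, v)).
by rewrite inE; split; rewrite /= in_itv.
Qed.

Lemma jcont_x (a : R -> R -> R) (x y : R) : jcont a x y ->
  {for x, continuous (a ^~ y)}.
Proof.
move=> ca; rewrite /prop_for /continuous_at.
apply: (@continuous2_cvg R _ _ _ (nbhs x) _ id (cst y) a x y ca).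
  exact: cvg_id.
exact: cvg_cst.
Qed.

Lemma jcont_integrable (a : R -> R -> R) (T y : R) :
  (forall x, 0 <= x <= T -> jcont a x y) ->
  mu.-integrable `[0, T] (EFin \o a ^~ y).
Proof.
move=> ca; apply: continuous_compact_integrable; first exact: segment_compact.
apply: continuous_in_subspaceT => x; rewrite inE/= in_itv/= => /ca.
exact: jcont_x.
Qed.

Lemma contour_shift (a b ax bx : R -> R -> R) (T beta : R) : 0 < T -> 0 < beta ->
  (forall x y, 0 <= x <= T -> - beta <= y <= beta -> CR a b ax bx x y) ->
  (forall y, - beta < y < beta -> b 0 y = b T y) ->
  forall y, - beta < y < beta ->
  \int[mu]_(x in `[0, T]) a x y = \int[mu]_(x in `[0, T]) a x 0.
Proof.
move=> T0 beta0 cr ab y yb.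
pose I y := \int[mu]_(x in `[0, T]) a x y.
suff dI : forall y, y \in `](- beta), beta[ -> is_derive y (1 : R) I 0.
  apply: (@derive0_oo_cst I beta dI y).
  by rewrite in_itv.
move=> {yb}y yb.
(* The constant [M] is the integrable dominating function for differentiation under the integral
   sign: by Cauchy-Riemann, the y-derivative of [a] is - [bx]. *)
have [M HM] : exists M : R, forall x y, 0 <= x <= T -> - beta <= y <= beta ->
    `|bx x y| <= M.
  apply: jcont_bounded; [exact: ltW|exact: ltW|].
  by move=> u v uT vb; have [_ []] := cr _ _ uT vb.
have inI (v : R) : v \in `](- beta), beta[ -> - beta <= v <= beta.
  by rewrite in_itv/= => /andP[? ?]; apply/andP; split; exact: ltW.
have d1 v x : v \in `](- beta), beta[ -> x \in `[0, T] ->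
    is_derive v (1 : R) (a x) (- bx x v).
  by move=> /inI vb; rewrite in_itv/= => xT; have [[]] := cr _ _ xT vb.
have d1E v x : v \in `](- beta), beta[ -> x \in `[0, T] ->
    (partial1of2 (fun v x => a x v)) v x = - bx x v.
  by move=> vb xT; rewrite partial1of2E; have [_ ->] := d1 _ _ vb xT.
have intf v : v \in `](- beta), beta[ -> mu.-integrable `[0, T] (EFin \o a ^~ v).
  move=> /inI vb; apply: jcont_integrable => x xT.
  by have [_ []] := cr _ _ xT vb.
have derf v x : `](- beta), beta[%classic v -> `[0, T]%classic x -> derivable (a x) v 1.
  by move=> vb xT; have [] := d1 _ _ vb xT.
have M0 : 0 <= M.
  apply: le_trans (HM 0 0 _ _); first exact: normr_ge0.
    by rewrite lexx ltW.
  by apply/andP; split; lra.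
have intG : mu.-integrable `[0, T] (EFin \o cst M).
  apply: continuous_compact_integrable; first exact: segment_compact.
  by apply: continuous_subspaceT => ?; exact: cvg_cst.
have ub v x : `](- beta), beta[%classic v -> `[0, T]%classic x ->
    `|(partial1of2 (fun v x => a x v)) v x| <= M.
  move=> vb xT; rewrite (d1E _ _ vb xT) normrN; apply: HM; last exact: inI.
  by move: xT; rewrite /= in_itv.
have mT : measurable (`[0, T]%classic : set R) by exact: measurable_itv.
have dd := @derivable_under_integral _ _ _ mu (fun v x => a x v) _ mT y _ _ yb
  intf derf (cst M) (fun=> M0) intG ub.
have := @differentiation_under_integral _ _ _ mu (fun v x => a x v) _ mT y _ _ yb
  intf derf (cst M) (fun=> M0) intG ub.
rewrite derive1E => Hd.
apply: DeriveDef => //; rewrite Hd.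
have -> : \int[mu]_(x in `[0, T]) (partial1of2 (fun v x => a x v)) y x =
   \int[mu]_(x in `[0, T]) (- bx x y).
  by apply: eq_Rintegral => x; rewrite inE => xT; exact: d1E.
have yb' := inI _ yb.
have crx x : 0 <= x <= T -> CR a b ax bx x y by move=> xT; exact: cr.
have cbx : {within `[0, T], continuous (fun x => - bx x y)}.
  apply: continuous_in_subspaceT => x; rewrite inE/= in_itv/= => /crx[_ [_ _ _ cx]].
  exact: (jcont_x (jcontN cx)).
have cb x : 0 <= x <= T -> {for x, continuous (fun x => - b x y)}.
  by move=> /crx[_ [_ cx _ _]]; exact: (jcont_x (jcontN cx)).
have db x : x \in `]0, T[ -> is_derive x (1 : R) (fun x => - b x y) (- bx x y).
  rewrite in_itv/= => /andP[/ltW x0 /ltW xT].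
  have [|[_ bx' _ _] _] := crx x; first by rewrite x0.
  exact: is_deriveN bx'.
have dob : derivable_oo_LRcontinuous (fun x => - b x y) 0 T.
  split.
  - by move=> x /db[].
  - by apply: cvg_at_right_filter; apply: cb; rewrite lexx ltW.
  - by apply: cvg_at_left_filter; apply: cb; rewrite lexx ltW.
have dbE : {in `]0, T[, (fun x => - b x y)^`()%classic =1 (fun x => - bx x y)}.
  by move=> x /db[_]; rewrite derive1E.
rewrite /Rintegral (continuous_FTC2 T0 cbx dob dbE) (ab y).
  by rewrite -EFinB subrr.
by move: yb; rewrite in_itv.
Qed.

End contour_shift.

(** * Smooth bump functions *)

Section bump.
Context {R : realType}.
Implicit Types (p : {poly R}) (x t : R).

(** The flat function exp(-1/x), extended by 0. The polynomial in 1/x makes the family closed under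
    differentiation, with [dbump] acting on the polynomials. *)
Definition hbump p x : R := if 0 < x then p.[x^-1] * expR (- x^-1) else 0.

Definition dbump p : {poly R} := 'X ^+ 2 * (p - p^`()).

Lemma poly_le_exp p : exists2 C : R, 0 <= C &
  forall t, 0 <= t -> `|p.[t]| <= C * expR t.
Proof.
exists (\sum_(i < size p) `|p`_i| * i`!%:R).
  by apply: sumr_ge0 => i _; rewrite mulr_ge0.
move=> t t0; rewrite horner_coef (le_trans (ler_norm_sum _ _ _))// mulr_suml.
apply: ler_sum => i _; rewrite normrM -mulrA ler_wpM2l// ger0_norm ?exprn_ge0//.
case: {i}(nat_of_ord i) => [|i]; first by rewrite expr0 fact0 mul1r -expR0 ler_expR.
have := expR_ge1Dxn i t0.
have f0 : 0 < (i.+1`!%:R : R) by rewrite ltr0n fact_gt0.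
by rewrite -ler_pdivrMl// mulrC; apply: le_trans; rewrite lerDr.
Qed.

Lemma is_derive_hbump p x : is_derive x (1 : R) (hbump p) (hbump (dbump p) x).
Proof.
have [x0|x0|<-] := ltgtP 0 x.
- apply: (@near_eq_is_derive _ _ _ (fun t => p.[t^-1] * expR (- t^-1))).
    near=> t; rewrite /hbump ifT//; near: t; exact: lt_nbhsr.
  have dV : is_derive x (1 : R) (fun t : R => t^-1) (- x ^- 2).
    have := @is_deriveV R id x 1 1 (lt0r_neq0 x0) (is_derive_id _ _).
    by rewrite /GRing.scale/= mulr1.
  have dp : is_derive x (1 : R) (fun t => p.[t^-1]) (p^`().[x^-1] * (- x ^- 2)).
    exact: (@is_derive1_comp R (horner p) (fun t : R => t^-1)).
  have de : is_derive x (1 : R) (fun t => expR (- t^-1)) (expR (- x^-1) * (x ^- 2)).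
    apply: (@is_derive1_comp R expR (fun t : R => - t^-1)).
    by rewrite -[x ^- 2]opprK; exact: is_deriveN.
  apply: is_derive_eq.
  rewrite /hbump x0 /dbump /GRing.scale/= !hornerE/= -exprVn; ring.
- rewrite {2}/hbump ltNge (ltW x0)/=.
  apply: (@near_eq_is_derive _ _ _ (fun=> 0)).
  near=> t; rewrite /hbump ifF//; apply/negbTE; rewrite -leNgt ltW//.
  near: t; exact: lt_nbhsl.
- rewrite {2}/hbump ltxx.
  (* At t = 1/h, the bound t^2 |p(t)| <= C exp t reads |hbump p h| <= C h^2, which forces the
     derivative 0 at the origin. *)
  have [C C0 HC] := poly_le_exp ('X ^+ 2 * p).
  apply: (is_derive_quad (e := 1) (C := C) ltr01) => h _.
  rewrite add0r {2}/hbump ltxx mul0r !subr0 /hbump.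
  case: ifPn => [h0|_]; last by rewrite normr0 mulr_ge0 ?sqr_ge0.
  have h20 : 0 < h ^+ 2 by rewrite exprn_gt0.
  have := HC h^-1; rewrite invr_ge0 => /(_ (ltW h0)) K.
  rewrite normrM expRN [`| _^-1|]ger0_norm ?invr_ge0 ?expR_ge0//.
  rewrite ler_pdivrMr ?expR_gt0// mulrAC -ler_pdivrMr//.
  apply: le_trans K; rewrite hornerM hornerXn normrM exprVn.
  by rewrite [`|h ^- 2|]ger0_norm ?invr_ge0 ?sqr_ge0// mulrC.
Unshelve. all: end_near. Qed.

(* The derivatives of [fun x => hbump p (x - a) * hbump q (b - x)] are sums of
   functions of the same form. *)
Inductive bump_span (a b : R) : (R -> R) -> Prop :=
| bump_gen p q : bump_span a b (fun x => hbump p (x - a) * hbump q (b - x))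
| bump_add f g : bump_span a b f -> bump_span a b g ->
    bump_span a b (fun x => f x + g x).

Lemma bump_span_derive a b f : bump_span a b f ->
  exists2 g, bump_span a b g & forall x, is_derive x (1 : R) f (g x).
Proof.
elim=> [p q|f1 f2 _ [g1 s1 d1] _ [g2 s2 d2]]; last first.
  exists (fun x => g1 x + g2 x); first exact: bump_add.
  by move=> x; exact: is_deriveD.
(* The minus sign produced by the inner function b - x is absorbed into the polynomial as [- q], so
   the span needs no scalar multiples. *)
exists (fun x => hbump (dbump p) (x - a) * hbump q (b - x)
    + hbump p (x - a) * hbump (dbump (- q)) (b - x)).
  by apply: bump_add; exact: bump_gen.
move=> x.
have dx : is_derive x (1 : R) (fun x => x - a) 1.
  by apply: is_derive_eq; rewrite subr0.
have dy : is_derive x (1 : R) (fun x => b - x) (-1).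
  by apply: is_derive_eq; rewrite add0r mul1r.
have d1 := @is_derive1_comp R (hbump p) (fun x => x - a) x _ _ (is_derive_hbump _ _) dx.
have d2 := @is_derive1_comp R (hbump q) (fun x => b - x) x _ _ (is_derive_hbump _ _) dy.
have -> : hbump (dbump (- q)) (b - x) = - hbump (dbump q) (b - x).
  by rewrite /hbump; case: ifP => _; rewrite ?oppr0// /dbump derivN !hornerE/=; ring.
apply: (is_derive_eq (is_deriveM d1 d2)).
by rewrite /GRing.scale/=; ring.
Qed.

Definition smooth_bump a b x := hbump 1 (x - a) * hbump 1 (b - x).

Lemma smooth_bump_out a b x : ~~ (a <= x <= b) -> smooth_bump a b x = 0.
Proof.
rewrite negb_and -!ltNge /smooth_bump /hbump => /orP[xa|bx].
  by rewrite ltNge subr_le0 (ltW xa)/= mul0r.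
by rewrite [in X in _ * X]ltNge subr_le0 (ltW bx)/= mulr0.
Qed.

Lemma smooth_bump_test (T a b : R) : 0 < a -> a <= b -> b < T ->
  test_function T (smooth_bump a b).
Proof.
move=> a0 ab bT; split.
  have S n : bump_span a b (derive1n n (smooth_bump a b)).
    elim: n => [|n IH]; first exact: bump_gen.
    have [g Sg dg] := bump_span_derive IH.
    suff -> : derive1n n.+1 (smooth_bump a b) = g by [].
    by apply/funext => x; rewrite derive1nS derive1E; have [_ ->] := dg x.
  by move=> n x; have [g _ dg] := bump_span_derive (S n); have [] := dg x.
by exists a, b; split => //; exact: smooth_bump_out.
Qed.

Lemma smooth_bump_ge0 a b x : 0 <= smooth_bump a b x.
Proof.
have h y : 0 <= hbump 1 y by rewrite /hbump; case: ifP; rewrite ?hornerE ?expR_ge0.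
exact: mulr_ge0.
Qed.

Lemma smooth_bump_gt0 a b x : a < x < b -> 0 < smooth_bump a b x.
Proof.
move=> /andP[ax xb].
by rewrite /smooth_bump /hbump !subr_gt0 ax xb !hornerC !mul1r mulr_gt0 ?expR_gt0.
Qed.

Lemma continuous_smooth_bump a b : continuous (smooth_bump a b).
Proof.
have [g _ dg] := bump_span_derive (bump_gen a b 1 1).
by move=> x; apply/differentiable_continuous/derivable1_diffP; case: (dg x).
Qed.

End bump.

(** * Weak derivatives *)

Section weak_derivatives.
Context {R : realType}.
Local Notation mu := (@lebesgue_measure R).
Implicit Types (T : R) (w phi : R -> R).

Lemma Rintegral_segment_gt0 (K : R -> R) (T a b m : R) :
  0 <= a -> a < b -> b <= T -> 0 < m ->
  {within `[0, T], continuous K} -> (forall x, 0 <= x <= T -> 0 <= K x) ->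
  (forall x, a <= x <= b -> m <= K x) -> 0 < \int[mu]_(x in `[0, T]) K x.
Proof.
move=> a0 ab bT m0 cK K0 Km.
have sub : `[a, b]%classic `<=` `[0, T]%classic.
  move=> x; rewrite /= !in_itv/= => /andP[ax xb].
  by rewrite (le_trans a0 ax) (le_trans xb bT).
have iT : mu.-integrable `[0, T] (EFin \o K).
  by apply: continuous_compact_integrable => //; exact: segment_compact.
have iab : mu.-integrable `[a, b] (EFin \o K).
  apply: continuous_compact_integrable; first exact: segment_compact.
  exact: continuous_subspaceW sub cK.
have im : mu.-integrable `[a, b] (EFin \o cst m).
  apply: continuous_compact_integrable; first exact: segment_compact.
  by apply: continuous_subspaceT => ?; exact: cvg_cst.
apply: (@lt_le_trans _ _ (\int[mu]_(x in `[a, b]) K x)); last first.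
  rewrite /Rintegral fine_le//.
  - by apply: integrable_fin_num => //; exact: measurable_itv.
  - by apply: integrable_fin_num => //; exact: measurable_itv.
  apply: ge0_subset_integral => //.
  exact: (measurable_int mu).
apply: (@lt_le_trans _ _ (\int[mu]_(x in `[a, b]) m)); last first.
  apply: le_Rintegral => // x; rewrite /= in_itv/=; exact: Km.
rewrite Rintegral_cst; last exact: measurable_itv.
have := @lebesgue_measure_itv R `[a, b]; rewrite /= lte_fin ab -EFinD => ->.
by rewrite /= mulr_gt0// subr_gt0.
Qed.

(** Were w(x) > 0, then w >= w(x)/2 near x, and a bump supported there would have a positive
    integral against w. The one-sided form is applied to a function and to its opposite. *)
Lemma weak_vanish_le0 T w : 0 < T -> {within `[0, T], continuous w} ->
  (forall phi, test_function T phi -> \int[mu]_(x in `[0, T]) (w x * phi x) = 0) ->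
  forall x, 0 <= x <= T -> w x <= 0.
Proof.
move=> T0 cw Hw x /andP[x0 xT]; rewrite leNgt; apply/negP => wx.
have xin : `[0, T]%classic x by rewrite /= in_itv/= x0 xT.
move/subspace_continuousP : (cw) => /(_ x xin) /cvgrPdist_lt /(_ (w x / 2)).
rewrite divr_gt0// => /(_ isT); rewrite near_withinE => -[e /= e0 He].
have {}He y : 0 <= y <= T -> `|x - y| < e -> w x / 2 <= w y.
  move=> yT xy; have yin : y \in `[0, T] by rewrite in_itv.
  have : `|w x - w y| < w x / 2 := He y xy yin.
  by rewrite ltr_norml => /andP[_ ?]; lra.
(* Since x may be an endpoint, the neighbourhood is cut to [0, T]. Three nested intervals follow:
   the support [a, b] lies strictly inside ]l, u[, hence inside ]0, T[, and on [a', b'] strictly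
   inside ]a, b[ the bump has a positive minimum. *)
pose l := Num.max 0 (x - e); pose u := Num.min T (x + e).
have lu : l < u by rewrite lt_min !gt_max T0 /=; apply/and3P; split; lra.
have l0 : 0 <= l by rewrite le_max lexx.
have lx : x - e <= l by rewrite le_max lexx orbT.
have uT : u <= T by rewrite ge_min lexx.
have ux : u <= x + e by rewrite ge_min lexx orbT.
move: l u lu l0 lx uT ux => l u lu l0 lx uT ux.
pose a := (2 * l + u) / 3; pose b := (l + 2 * u) / 3.
have la : l < a by rewrite /a; lra.
have ab : a < b by rewrite /a /b; lra.
have bu : b < u by rewrite /b; lra.
move: a b la ab bu => a b la ab bu.
pose a' := (2 * a + b) / 3; pose b' := (a + 2 * b) / 3.
have aa' : a < a' by rewrite /a'; lra.
have ab' : a' < b' by rewrite /a' /b'; lra.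
have bb' : b' < b by rewrite /b'; lra.
move: a' b' aa' ab' bb' => a' b' aa' ab' bb'.
have [|c cab Hc] := @EVT_min R (smooth_bump a b) a' b' (ltW ab').
  by apply: continuous_subspaceT => ?; exact: continuous_smooth_bump.
have c0 : 0 < smooth_bump a b c.
  move: cab; rewrite in_itv/= => /andP[? ?].
  by apply: smooth_bump_gt0; apply/andP; split; lra.
have tb : test_function T (smooth_bump a b).
  by apply: smooth_bump_test; [lra|exact: ltW|lra].
suff : 0 < \int[mu]_(x in `[0, T]) (w x * smooth_bump a b x) by rewrite Hw// ltxx.
have wy y : 0 <= y <= T -> a <= y <= b -> w x / 2 <= w y.
  move=> yT /andP[ay yb]; apply: He => //.
  by rewrite ltr_norml; apply/andP; split; lra.
apply: (@Rintegral_segment_gt0 _ T a' b' (w x / 2 * smooth_bump a b c)) => //.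
- lra.
- lra.
- by rewrite mulr_gt0// divr_gt0.
- move=> y; apply: continuousM; first exact: cw.
  by apply: continuous_subspaceT => ?; exact: continuous_smooth_bump.
- move=> y yT.
  have [ayb|nayb] := boolP (a <= y <= b).
    by rewrite mulr_ge0 ?smooth_bump_ge0// (le_trans _ (wy _ yT ayb))// divr_ge0// ltW.
  by rewrite smooth_bump_out// mulr0.
- move=> y /andP[ay yb]; apply: ler_pM.
  + by rewrite divr_ge0// ltW.
  + exact: ltW.
  + by apply: wy; apply/andP; split; lra.
  + by apply: Hc; rewrite in_itv/= ay yb.
Qed.

(** Outside its support [phi] vanishes on an open set, hence so do its derivatives. This removes the
    boundary terms in the integrations by parts. *)
Lemma test_function_derive1n T phi n : test_function T phi ->
  derive1n n phi 0 = 0 /\ derive1n n phi T = 0.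
Proof.
move=> [_ [a [b [a0 ab bT H]]]].
have key x : ~~ (a <= x <= b) -> derive1n n phi x = 0.
  elim: n x => [//|n IH] x xab.
  rewrite derive1nS derive1E.
  rewrite (@near_eq_derive _ _ _ _ (cst 0)); first by rewrite derive_cst.
  move: xab; rewrite negb_and -!ltNge => /orP[xa|bx].
    near=> t; apply: IH; rewrite negb_and -ltNge; apply/orP; left.
    by near: t; exact: lt_nbhsl.
  near=> t; apply: IH; rewrite negb_and -!ltNge; apply/orP; right.
  by near: t; exact: lt_nbhsr.
by split; apply: key; rewrite negb_and -!ltNge ?a0 ?bT ?orbT.
Unshelve. all: end_near. Qed.

(** The index [i] is general because each integration by parts replaces [al i] by [al i.+1] while
    lowering the order on [phi]. *)
Lemma weak_by_parts T (al : nat -> R -> R) phi j i : 0 < T ->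
  (forall i x, 0 <= x <= T -> is_derive x (1 : R) (al i) (al i.+1 x)) ->
  test_function T phi ->
  \int[mu]_(x in `[0, T]) (al i x * derive1n j phi x) =
  (-1) ^+ j * \int[mu]_(x in `[0, T]) (al (i + j)%N x * phi x).
Proof.
move=> T0 dal tphi.
have cal k x : 0 <= x <= T -> {for x, continuous (al k)}.
  by move=> xT; apply/differentiable_continuous/derivable1_diffP; case: (dal k x xT).
have cwal k : {within `[0, T], continuous (al k)}.
  apply: continuous_in_subspaceT => x; rewrite inE/= in_itv/=; exact: cal.
have [dphi _] := tphi.
have cphi k : continuous (derive1n k phi).
  by move=> x; apply/differentiable_continuous/derivable1_diffP; exact: dphi.
elim: j i => [|j IH] i; first by rewrite expr0 mul1r addn0.
have [p0 pT] := test_function_derive1n j tphi.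
rewrite derive1nS (@Rintegration_by_parts R (al i) (derive1n j phi) (al i.+1)).
- rewrite p0 pT !mulr0 subrr sub0r.
  rewrite (IH i.+1) exprS mulN1r mulNr addSnnS//.
- exact: T0.
- exact: cwal.
- split.
  + move=> x; rewrite in_itv/= => /andP[/ltW x0 /ltW xT].
    by have [|] := dal i x; first by rewrite x0.
  + by apply: cvg_at_right_filter; apply: cal; rewrite lexx ltW.
  + by apply: cvg_at_left_filter; apply: cal; rewrite lexx ltW.
- move=> x; rewrite in_itv/= => /andP[/ltW x0 /ltW xT].
  by rewrite derive1E; have [|_ ->] := dal i x; first by rewrite x0.
- by apply: continuous_subspaceT => ?; rewrite -derive1nS; exact: cphi.
- split.
  + by move=> x _; exact: dphi.
  + by apply: cvg_at_right_filter; apply: cphi.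
  + by apply: cvg_at_left_filter; apply: cphi.
- by move=> x _.
Qed.

End weak_derivatives.

(** * Equality of the derivatives of F at 0 and T *)

Section derivatives_at_endpoints.
Context {R : realType}.
Local Notation mu := (@lebesgue_measure R).
Implicit Types (T : R) (F u v : R[i] -> R[i]) (D f : R -> R[i]).

Lemma weak_deriv_unique T (al : nat -> R -> R) (v : R -> R) j : 0 < T ->
  (forall i x, 0 <= x <= T -> is_derive x (1 : R) (al i) (al i.+1 x)) ->
  {within `[0, T], continuous v} ->
  (forall phi, test_function T phi ->
    \int[mu]_(x in `[0, T]) (al 0%N x * derive1n j phi x) =
    (-1) ^+ j * \int[mu]_(x in `[0, T]) (v x * phi x)) ->
  forall x, 0 <= x <= T -> al j x = v x.
Proof.
move=> T0 dal cv Hv x xT.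
have cal : {within `[0, T], continuous (al j)}.
  apply: continuous_in_subspaceT => y; rewrite inE/= in_itv/= => yT.
  by apply/differentiable_continuous/derivable1_diffP; case: (dal j y yT).
have icont (k : R -> R) : {within `[0, T], continuous k} ->
    mu.-integrable `[0, T] (EFin \o k).
  by move=> ck; apply: continuous_compact_integrable => //; exact: segment_compact.
have mT : measurable (`[0, T]%classic : set R) by exact: measurable_itv.
have H phi : test_function T phi ->
    \int[mu]_(y in `[0, T]) (al j y * phi y) = \int[mu]_(y in `[0, T]) (v y * phi y).
  move=> tphi; have := Hv _ tphi.
  by rewrite (weak_by_parts _ _ T0 dal tphi) add0n; apply: mulfI; rewrite signr_eq0.
have cphi phi : test_function T phi -> {within `[0, T], continuous phi}.
  move=> [dphi _]; apply: continuous_subspaceT => y.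
  by apply/differentiable_continuous/derivable1_diffP; exact: (dphi 0%N).
have iM (k phi : R -> R) : {within `[0, T], continuous k} -> test_function T phi ->
    mu.-integrable `[0, T] (EFin \o (fun y => k y * phi y)).
  move=> ck /cphi cp; apply: icont => y; apply: continuousM; [exact: ck|exact: cp].
apply/eqP; rewrite eq_le -subr_le0 -[X in _ && X]subr_le0; apply/andP; split.
- apply: (weak_vanish_le0 (w := fun y => al j y - v y) T0 _ _ xT).
    by move=> y; apply: continuousB; [exact: cal|exact: cv].
  move=> phi tphi; under eq_Rintegral do rewrite mulrBl.
  by rewrite RintegralB ?H ?subrr//; exact: iM.
- apply: (weak_vanish_le0 (w := fun y => v y - al j y) T0 _ _ xT).
    by move=> y; apply: continuousB; [exact: cv|exact: cal].
  move=> phi tphi; under eq_Rintegral do rewrite mulrBl.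
  by rewrite RintegralB ?H ?subrr//; exact: iM.
Qed.

Lemma within_continuous_ReIm (A : set R) D :
  {within A, continuous (D : R -> (R[i])^o)} ->
  {within A, continuous (fun x => complex.Re (D x))} /\
  {within A, continuous (fun x => complex.Im (D x))}.
Proof.
move=> /subspace_continuousP cderive.
have key (p : R[i] -> R) : (forall z, `|p z| <= cmod z) ->
    (forall z w, p (z - w) = p z - p w) -> {within A, continuous (fun x => p (D x))}.
  move=> pc pB; apply/subspace_continuousP => x Ax.
  have /cvgrPdist_lt cDx := cderive x Ax.
  apply/cvgrPdist_lt => e e0.
  have e0' : (0 : R[i]) < e%:C%C by rewrite ltcR.
  apply: filterS (cDx _ e0') => y; rewrite normE ltcR => H.
  by rewrite -pB (le_lt_trans (pc _)).
by split; apply: key; [exact: Re_cmod|exact: ReB|exact: Im_cmod|exact: ImB].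
Qed.

Lemma Re_mulr (z : R[i]) (r : R) : complex.Re (z * r%:C%C) = complex.Re z * r.
Proof. by case: z => a b /=; rewrite mulr0 subr0. Qed.

Lemma Im_mulr (z : R[i]) (r : R) : complex.Im (z * r%:C%C) = complex.Im z * r.
Proof. by case: z => a b /=; rewrite mulr0 add0r. Qed.

Lemma signr_complex j : (-1 : R[i]) ^+ j = ((-1) ^+ j)%:C%C.
Proof. by rewrite rmorphXn/= rmorphN rmorph1. Qed.

Lemma calH_infty_derivatives T F f : 0 < T -> calH_infty T f ->
  (forall x, 0 <= x <= T -> F (x +i* 0)%C = f x) ->
  (forall j x, 0 <= x <= T ->
    is_cderive (iter j cderive F) (x +i* 0)%C (iter j.+1 cderive F (x +i* 0)%C)) ->
  forall j, iter j cderive F (0 +i* 0)%C = iter j cderive F (T +i* 0)%C.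
Proof.
(* The order is j + 1 because [calH] at order s gives continuity and equal endpoint values only
   below s. *)
move=> T0 Hf Ff dF j; have [D [_ wD ctsD _]] := Hf j.+1.
have [cDj DT] := ctsD j (ltnSn j); have [_ wDj] := wD j (leqnSn j).
have [cRe cIm] := within_continuous_ReIm cDj.
(* Test functions are real, so both projections commute with the products and the integral, and the
   weak identity splits into two real ones. *)
have cint_eq (p : R[i] -> R) : p = @complex.Re R \/ p = @complex.Im R ->
    forall phi, test_function T phi ->
    \int[mu]_(x in `[0, T]) (p (F (x +i* 0)%C) * derive1n j phi x) =
    (-1) ^+ j * \int[mu]_(x in `[0, T]) (p (D j x) * phi x).
  move=> Hp phi tphi.
  have pM z r : p (z * r%:C%C) = p z * r by case: Hp => ->; [exact: Re_mulr|exact: Im_mulr].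
  have pcint g : p (cint T g) = \int[mu]_(x in `[0, T]) p (g x) by case: Hp => ->.
  have := congr1 p (wDj _ tphi).
  rewrite signr_complex mulrC pM !pcint mulrC => H.
  transitivity (\int[mu]_(x in `[0, T]) p (f x * (derive1n j phi x)%:C%C)).
    apply: eq_Rintegral => x; rewrite inE/= in_itv/= => xT.
    by rewrite pM Ff.
  rewrite H; congr (_ * _).
  by apply: eq_Rintegral => x _; rewrite pM.
have ReD x : 0 <= x <= T -> ReF (iter j cderive F) x 0 = complex.Re (D j x).
  move=> xT; apply: (@weak_deriv_unique T (fun i x => ReF (iter i cderive F) x 0)
    (fun x => complex.Re (D j x)) j T0 _ cRe _ x xT).
    by move=> i y yT; have [] := is_cderive_partials (dF i y yT).
  by apply: cint_eq; left.
have ImD x : 0 <= x <= T -> ImF (iter j cderive F) x 0 = complex.Im (D j x).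
  move=> xT; apply: (@weak_deriv_unique T (fun i x => ImF (iter i cderive F) x 0)
    (fun x => complex.Im (D j x)) j T0 _ cIm _ x xT).
    by move=> i y yT; have [] := is_cderive_partials (dF i y yT).
  by apply: cint_eq; right.
have FD x : 0 <= x <= T -> iter j cderive F (x +i* 0)%C = D j x.
  move=> xT; have := ReD x xT; have := ImD x xT; rewrite /ReF /ImF.
  by case: (iter j cderive F _) (D j x) => [a b] [c d] /= -> ->.
by rewrite !FD// ?lexx ?ltW.
Qed.

End derivatives_at_endpoints.

(** * Periodicity and decay *)

Section identity_on_segment.
Context {R : realType}.
Implicit Types F : R[i] -> R[i].

(* The property that all derivatives agree is open by Taylor expansion and
   closed by continuity; its indicator function thus has zero derivative. *)
Lemma germ_along_segment F (x0 x1 beta : R) :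
  (forall x y, (x = x0 \/ x = x1) -> - beta <= y <= beta ->
    forall j, exists r a, has_ps (iter j cderive F) (x +i* y)%C r a) ->
  (forall j, iter j cderive F (x0 +i* 0)%C = iter j cderive F (x1 +i* 0)%C) ->
  forall y, - beta < y < beta ->
  forall j, iter j cderive F (x0 +i* y)%C = iter j cderive F (x1 +i* y)%C.
Proof.
move=> Fps F0 y yb.
pose P y := forall j, iter j cderive F (x0 +i* y)%C = iter j cderive F (x1 +i* y)%C.
pose g y : R := `[< P y >]%:R.
suff dg : forall y, y \in `](- beta), beta[ -> is_derive y (1 : R) g 0.
  have := derive0_oo_cst dg (y := y); rewrite in_itv/= => /(_ yb).
  rewrite /g; have -> : `[< P 0 >] by apply/asboolP.
  by case: asboolP => // _ /eqP; rewrite eq_sym oner_eq0.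
move=> {yb}y; rewrite in_itv/= => /andP[yb yb'].
have yb2 : - beta <= y <= beta by rewrite !ltW.
suff gy : \forall t \near y, cst (g y) t = g t.
  exact: (@near_eq_is_derive _ _ _ (cst (g y)) g y 1 0 gy (is_derive_cst _ _ _)).
have [Py|nPy] := pselect (P y).
  have [r [a Fa]] := Fps x0 y (or_introl erefl) yb2 0%N.
  have [r' [b Fb]] := Fps x1 y (or_intror erefl) yb2 0%N.
  have r0 : 0 < Num.min r r' by rewrite lt_min; case: Fa => ->; case: Fb => ->.
  exists (Num.min r r') => // t /= ty.
  rewrite /g; congr (_%:R); congr nat_of_bool; apply/asbool_equiv_eq; split => // _ j.
  have cy : cmod (0 +i* (t - y))%C < Num.min r r'.
    by rewrite /cmod/= expr0n/= add0r sqrtr_sqr distrC.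
  have := has_ps_germ Fa Fb Py j cy.
  by congr (iter j cderive F _ = iter j cderive F _); simpc; congr (_ +i* _)%C; ring.
(* Closedness: an order [j] that separates the two sides at height y still separates them at nearby
   heights, by continuity. *)
have [j nFj] : exists j, iter j cderive F (x0 +i* y)%C != iter j cderive F (x1 +i* y)%C.
  by apply: contra_notP nPy => /forallNP H j; apply/eqP/negPn/negP; exact: H.
have dF x : (x = x0 \/ x = x1) -> {for y, continuous (ReF (iter j cderive F) x)} /\
    {for y, continuous (ImF (iter j cderive F) x)}.
  move=> xx; have [r [a Fa]] := Fps x y xx yb2 j.
  have [_ _ d1 d2] := is_cderive_partials (has_ps_is_cderive Fa).
  by split; apply/differentiable_continuous/derivable1_diffP; [case: d1|case: d2].
have [R0 I0] := dF x0 (or_introl erefl); have [R1 I1] := dF x1 (or_intror erefl).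
have near_neq (p q : R -> R) : {for y, continuous p} -> {for y, continuous q} ->
    p y != q y -> \forall t \near y, p t != q t.
  move=> cp cq; rewrite -subr_eq0 => pq.
  have H : \forall t \near y, (p t - q t) != 0.
    exact: (cvgr_neq0 _ (continuousB cp cq) pq).
  by apply: filterS H => t; rewrite subr_eq0.
have : \forall t \near y, iter j cderive F (x0 +i* t)%C != iter j cderive F (x1 +i* t)%C.
  have [Req|Rneq] := eqVneq (ReF (iter j cderive F) x0 y) (ReF (iter j cderive F) x1 y).
    have Ineq : ImF (iter j cderive F) x0 y != ImF (iter j cderive F) x1 y.
      apply: contra nFj; move: Req; rewrite /ReF /ImF.
      by case: (iter j cderive F _) (iter j cderive F (x1 +i* y)%C) => [a b] [c d] /=
        -> /eqP ->.
    apply: filterS (near_neq _ _ I0 I1 Ineq) => t; apply: contra => /eqP.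
    by rewrite /ImF => ->.
  apply: filterS (near_neq _ _ R0 R1 Rneq) => t; apply: contra => /eqP.
  by rewrite /ReF => ->.
apply: filterS => t nt; rewrite /cst /g; congr (_%:R); congr nat_of_bool.
apply/asbool_equiv_eq; split => // /(_ j) H.
by rewrite H eqxx in nt.
Qed.

End identity_on_segment.

(** * Exponential bounds for the Fourier coefficients *)

Section fourier_decay.
Context {R : realType}.
Local Notation mu := (@lebesgue_measure R).

Lemma cossin_intperiod (k : int) :
  cos (2 * pi * k%:~R) = 1 :> R /\ sin (2 * pi * k%:~R) = 0 :> R.
Proof.
have key (n : nat) : cos (2 * pi * n%:R) = 1 :> R /\ sin (2 * pi * n%:R) = 0 :> R.
  rewrite (_ : 2 * pi * n%:R = 0 + (pi *+ 2) *+ n); last first.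
    by rewrite add0r -[(pi *+ 2) *+ n]mulr_natr -[pi *+ 2]mulr_natl.
  by rewrite (periodicn (@cosD2pi R)) (periodicn (@sinD2pi R)) cos0 sin0.
case: k => n; first exact: key.
have [kc ks] := key n.+1.
by rewrite NegzE rmorphN/= mulrN cosN sinN kc ks oppr0.
Qed.

Lemma fourier_coef_bound (T beta : R) (F : R[i] -> R[i]) (f : R -> R[i]) :
  0 < T -> 0 < beta ->
  (forall x, 0 <= x <= T -> F (x +i* 0)%C = f x) ->
  (forall x y, 0 <= x <= T -> - beta <= y <= beta ->
    CR (ReF F) (ImF F) (ReF (cderive F)) (ImF (cderive F)) x y) ->
  (forall y, - beta < y < beta -> F (0 +i* y)%C = F (T +i* y)%C) ->
  exists2 M, 0 <= M & forall (k : int) y, - beta < y < beta ->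
    cmod (fourier_coef T f k) <= M * expR (omega T k%:~R * y).
Proof.
move=> T0 beta0 Ff crF per.
have [M1 HM1] : exists M : R, forall x y, 0 <= x <= T -> - beta <= y <= beta ->
    `|ReF F x y| <= M.
  apply: jcont_bounded => [||x y xT yb]; [exact: ltW|exact: ltW|].
  by have [_ []] := crF x y xT yb.
have [M2 HM2] : exists M : R, forall x y, 0 <= x <= T -> - beta <= y <= beta ->
    `|ImF F x y| <= M.
  apply: jcont_bounded => [||x y xT yb]; [exact: ltW|exact: ltW|].
  by have [_ []] := crF x y xT yb.
have z0T : 0 <= (0 : R) <= T by rewrite lexx ltW.
have z0b : - beta <= 0 <= beta by rewrite oppr_le0 !ltW.
have M10 : 0 <= M1 by apply: le_trans (HM1 0 0 z0T z0b).
have M20 : 0 <= M2 by apply: le_trans (HM2 0 0 z0T z0b).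
(* The real and the imaginary integral are each at most T (M1 + M2) exp(w y), and T cancels against
   the factor 1/T. *)
exists (2 * (M1 + M2)) => [|k y yb]; first by rewrite mulr_ge0// addr_ge0.
set w := omega T k%:~R.
(* With z = x + iy, c + i d is exp(- i w z), of modulus exp(w y), and a + i b is its product with
   F(z). *)
pose c x y := expR (w * y) * cos (w * x).
pose d x y := - (expR (w * y) * sin (w * x)).
pose a x y := ReF F x y * c x y - ImF F x y * d x y.
pose b x y := ReF F x y * d x y + ImF F x y * c x y.
have crG x v (xT : 0 <= x <= T) (vb : - beta <= v <= beta) :=
  CR_mul (crF x v xT vb) (CR_exp w x v).
(* Here k being an integer matters: it makes exp(- i w z) take equal values on the two vertical
   sides. *)
have wT : w * T = 2 * pi * k%:~R by rewrite /w /omega mulfVK ?gt_eqF.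
have [cw sw] := cossin_intperiod k.
have cdper v : c 0 v = c T v /\ d 0 v = d T v.
  by rewrite /c /d wT cw sw mulr0 cos0 sin0.
have aper v : - beta < v < beta -> a 0 v = a T v.
  by move=> vb; rewrite /a /ReF /ImF per//; have [-> ->] := cdper v.
have bper v : - beta < v < beta -> b 0 v = b T v.
  by move=> vb; rewrite /b /ReF /ImF per//; have [-> ->] := cdper v.
have Ia := contour_shift T0 beta0 crG bper yb.
(* For the pair (b, - a) the endpoint condition bears on - a, whence [aper]. *)
have Ib := contour_shift T0 beta0 (fun x v xT vb => CR_rot (crG x v xT vb))
  (fun v vb => congr1 -%R (aper v vb)) yb.
have yb2 : - beta <= y <= beta by case/andP: yb => ? ?; rewrite !ltW.
have bnd (g : R -> R -> R) :
    (forall x, 0 <= x <= T -> jcont g x y) ->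
    (forall x, 0 <= x <= T -> `|g x y| <= (M1 + M2) * expR (w * y)) ->
    `|\int[mu]_(x in `[0, T]) g x y| <= T * ((M1 + M2) * expR (w * y)).
  move=> cg Hg; have ig := jcont_integrable cg.
  apply: (le_trans (le_normr_Rintegral _ ig)); first exact: measurable_itv.
  apply: (@le_trans _ _ (\int[mu]_(x in `[0, T]) ((M1 + M2) * expR (w * y)))).
    apply: le_Rintegral => //.
    - exact: (integrable_norm ig).
    - apply: continuous_compact_integrable; first exact: segment_compact.
      by apply: continuous_subspaceT => ?; exact: cvg_cst.
  rewrite Rintegral_cst//.
  have := @lebesgue_measure_itv R `[0, T]; rewrite /= lte_fin T0 -EFinD => ->.
  by rewrite /= subr0 mulrC.
have e0 := expR_ge0 (w * y).
have cd_le x : `|c x y| <= expR (w * y) /\ `|d x y| <= expR (w * y).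
  rewrite /c /d normrN !normrM (ger0_norm e0).
  by rewrite !ler_piMr// ler_norml ?cos_geN1 ?cos_le1 ?sin_geN1 ?sin_le1.
have ab_le x : 0 <= x <= T ->
    `|a x y| <= (M1 + M2) * expR (w * y) /\ `|b x y| <= (M1 + M2) * expR (w * y).
  move=> xT; have [cl dl] := cd_le x; have m1 := HM1 x y xT yb2; have m2 := HM2 x y xT yb2.
  split; rewrite mulrDl.
    rewrite (le_trans (ler_normB _ _))//.
    rewrite [`|ReF F x y * _|]normrM [`|ImF F x y * _|]normrM.
    by apply: lerD; apply: ler_pM.
  rewrite (le_trans (ler_normD _ _))//.
  rewrite [`|ReF F x y * _|]normrM [`|ImF F x y * _|]normrM.
  by apply: lerD; apply: ler_pM.
have ca x (xT : 0 <= x <= T) : jcont a x y by have [_ []] := crG x y xT yb2.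
have cb x (xT : 0 <= x <= T) : jcont b x y by have [_ []] := crG x y xT yb2.
have Ba := bnd a ca (fun x xT => (ab_le x xT).1).
have Bb := bnd b cb (fun x xT => (ab_le x xT).2).
rewrite /fourier_coef cmodM cmod_real ger0_norm ?invr_ge0 ?(ltW T0)//.
rewrite ler_pdivrMl//.
rewrite (le_trans (cmod_ReIm _))//=.
have f_ab x : 0 <= x <= T ->
    f x * cis (- (w * x)) = (a x 0 +i* b x 0)%C.
  move=> xT; rewrite /cis cosN sinN /a /b /c /d /ReF /ImF Ff// mulr0 expR0 !mul1r.
  by case: (f x) => u v.
rewrite [X in _ + `|X| <= _](_ : _ = \int[mu]_(x in `[0, T]) b x 0); last first.
  apply: eq_Rintegral => x; rewrite inE/= in_itv/= => xT.
  by rewrite -/w f_ab.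
rewrite [X in `|X| + _ <= _](_ : _ = \int[mu]_(x in `[0, T]) a x 0); last first.
  apply: eq_Rintegral => x; rewrite inE/= in_itv/= => xT.
  by rewrite -/w f_ab.
rewrite -Ia -Ib.
apply: (le_trans (lerD Ba Bb)); rewrite le_eqVlt; apply/predU1P; left; ring.
Qed.

(** Passage from the heights y < beta reached by the contour to beta itself: if the bound failed at
    beta, it would by continuity fail for some y just below. *)
Lemma expR_le_at_left (X M W beta : R) : 0 < beta ->
  (forall y, 0 <= y < beta -> X <= M * expR (- (W * y))) ->
  X <= M * expR (- (W * beta)).
Proof.
move=> beta0 H; rewrite leNgt; apply/negP => HX.
have cts : {for beta, continuous (fun y => M * expR (- (W * y)))}.
  apply: continuousM; first exact: cvg_cst.
  apply: (@continuous_comp _ _ _ (fun y : R => - (W * y)) expR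
    _ _ (@continuous_expR R _)).
  by apply: continuousN; apply: continuousM; [exact: cvg_cst|exact: cvg_id].
have nr : \forall y \near beta, M * expR (- (W * y)) < X.
  exact: cvgr_lt cts _ HX.
have nl : \forall y \near beta^'-, M * expR (- (W * y)) < X.
  by rewrite near_withinE; apply: filterS nr => y.
suff : \forall y \near beta^'-, False by move=> /filter_ex[].
near=> y.
have yb : y < beta by near: y; exact: nbhs_left_lt.
have y0 : 0 <= y by near: y; exact: nbhs_left_ge.
have : M * expR (- (W * y)) < X by near: y; exact: nl.
by rewrite ltNge H// y0 yb.
Unshelve. all: end_near. Qed.

End fourier_decay.

Unset Implicit Arguments.

Theorem theorem5p1 (R : realType) (T beta : R) (f : R -> R[i]) :
  0 < T -> 0 < beta -> calA T beta f ->
  (fun k : int => cmod (fourier_coef T f k)) =O_abs_pinfty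
  (fun k : int => expR (- omega T (`|k|%:~R * beta))).
Proof.
move=> T0 beta0 [Hf [U [F [_ SU FU Ff]]]].
have Fps x y : 0 <= x <= T -> - beta <= y <= beta -> forall j,
    exists r a, has_ps (iter j cderive F) (x +i* y)%C r a.
  move=> xT yb j; have [|r [a Fa]] := analytic_has_ps FU (z0 := (x +i* y)%C).
    exact: SU.
  by exists r, (iter j dseq a); exact: has_ps_iter.
have dF x y : 0 <= x <= T -> - beta <= y <= beta -> forall j,
    is_cderive (iter j cderive F) (x +i* y)%C (iter j.+1 cderive F (x +i* y)%C).
  by move=> xT yb j; have [r [a /has_ps_is_cderive]] := Fps x y xT yb j.
have z0b : - beta <= 0 <= beta by rewrite oppr_le0 !ltW.
have crF x y : 0 <= x <= T -> - beta <= y <= beta ->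
    CR (ReF F) (ImF F) (ReF (cderive F)) (ImF (cderive F)) x y.
  move=> xT yb.
  exact: (CR_is_cderive (dF x y xT yb 0%N) (dF x y xT yb 1%N)).
have F0T : forall j, iter j cderive F (0 +i* 0)%C = iter j cderive F (T +i* 0)%C.
  apply: (calH_infty_derivatives T0 Hf Ff) => j x xT; exact: dF.
have per y : - beta < y < beta -> F (0 +i* y)%C = F (T +i* y)%C.
  move=> yb; apply: (germ_along_segment _ F0T yb 0%N) => u v ux vb j.
  by apply: Fps => //; case: ux => ->; rewrite ?lexx ?ltW.
have [M M0 HM] := fourier_coef_bound T0 beta0 Ff crF per.
(* The constant must be positive while [M] may be 0. The estimate holds for every k, so the
   threshold is 0. *)
apply/eqO_exP; exists (M + 1); first by rewrite ltr_wpDl.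
exists 0%N => // k _.
change (`|cmod (fourier_coef T f k)| <=
  (M + 1) * `|expR (- omega T (`|k|%:~R * beta))|).
rewrite [`|cmod _|]ger0_norm ?cmod_ge0// [`|expR _|]ger0_norm ?expR_ge0//.
(* The contour moves to height s y with s opposite to the sign of k, so that the exponent becomes -
   omega_|k| y. *)
have [s ss] : exists2 s : R, (s = 1 \/ s = -1) & k%:~R * s = - `|k|%:~R :> R.
  have [k0|k0] := leP 0 k.
    by exists (-1); [right|rewrite ger0_norm// mulrN1].
  by exists 1; [left|rewrite ltr0_norm// mulr1 rmorphN opprK].
move=> ks.
have -> : omega T (`|k|%:~R * beta) = omega T `|k|%:~R * beta.
  by rewrite /omega mulrA -[RHS]mulrAC.
apply: le_trans (_ : M * expR (- (omega T `|k|%:~R * beta)) <= _); last first.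
  by rewrite ler_wpM2r ?expR_ge0// lerDl.
apply: expR_le_at_left => // y /andP[y0 yb].
have := HM k (s * y); rewrite (_ : omega T k%:~R * (s * y) = - (omega T `|k|%:~R * y)).
  by apply; case: ss => ->; apply/andP; split; lra.
by rewrite /omega -[`|k|%:~R]opprK -ks; ring.
Qed.
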